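(* Consider the cache network on the $\sqrt n\times\sqrt n$ grid (torus) with $n$ servers, library size $K$, cache size $M$, and $n$ requests. Suppose that $K=n$ and $M=n^{\alpha}$ for some constant $0<\alpha<1/2$. Then, under the Uniform popularity distribution ($p_i=1/K$ for all $i$), the maximum load $L$ of the Nearest Replica Strategy (Strategy I) lies in the interval $[\Omega(\log n/\log\log n),\,O(\log n)]$ with high probability.
   Context: Network: $n$ servers are the vertices of a $\sqrt n\times\sqrt n$ grid graph $G$; to avoid boundary effects $G$ is taken to be the torus (wrap-around grid), the asymptotic results being asserted for the grid as well. $d_G(u,v)$ is the shortest-path distance. Library and placement: there are $K$ files $W_1,\dots,W_K$ with popularity distribution $\mathcal P=(p_1,\dots,p_K)$. Each server independently caches $M$ files drawn i.i.d. from $\mathcal P$ with replacement ($M\le K$, and throughout $M\ll K$). Requests: after placement, $n$ requests arrive sequentially; each request originates at a server chosen uniformly at random and asks for a file drawn from $\mathcal P$, independently. Strategy I (Nearest Replica Strategy): each request is assigned to the nearest node, in the graph distance $d_G$, that has cached the requested file; ties are broken randomly. Maximum load: if $T_i$ is the number of requests assigned to server $i$ after all $n$ requests, then $L=\max_{1\le i\le n}T_i$. Asymptotics are as $n\to\infty$ (integer rounding is ignored). ''With high probability'' means with probability at least $1-1/n^c$ for some constant $c>0$. *)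

(* Defs.v *)
From HB Require Import structures.
From mathcomp Require Import all_boot all_order all_algebra.
From mathcomp Require Import all_classical all_reals all_analysis.

Set Implicit Arguments.
Unset Strict Implicit.
Unset Printing Implicit Defensive.

Import Order.TTheory GRing.Theory Num.Theory.
Local Open Scope ring_scope.

Section GraphDistance.
Variables (V : finType) (e : rel V).

Definition walk (k : nat) (u v : V) : bool :=
  [exists p : k.-tuple V, path e u p && (last u p == v)].

(* A shortest path has fewer than #|V| edges; #|V| is the value at vertices
   that are not connected. *)
Definition gdist (u v : V) : nat :=
  \big[minn/#|V|]_(k < #|V| | walk k u v) (k : nat).

End GraphDistance.

Definition cycle_adj (m : nat) : rel 'I_m :=
  [rel i j | (j == ordS i) || (i == ordS j)].

(* The condition u != v only matters for m = 1, where ordS is the identity. *)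
Definition torus_adj (m : nat) : rel ('I_m * 'I_m) :=
  [rel u v | (u != v) &&
     (((u.1 == v.1) && cycle_adj u.2 v.2) ||
      ((u.2 == v.2) && cycle_adj u.1 v.1))].

(* V: servers, e: adjacency, K: number of files, p: popularity,
   M: number of cache slots per server, q: number of requests. *)
Section CacheNetwork.
Variables (R : realType) (V : finType) (e : rel V).
Variables (K : nat) (p : 'I_K -> R) (M q : nat).

(* c s j is the file in slot j of server s; repetitions are allowed. *)
Definition placement : finType := {ffun V -> {ffun 'I_M -> 'I_K}}.

(* r i is the pair (origin, requested file) of request i. *)
Definition requests : finType := {ffun 'I_q -> V * 'I_K}.

(* a i is the server to which request i is assigned, None if it is unserved. *)
Definition assignment : finType := {ffun 'I_q -> option V}.

Definition placement_pmf (c : placement) : R := \prod_s \prod_j p (c s j).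

Definition requests_pmf (r : requests) : R :=
  \prod_i (#|V|%:R^-1 * p (r i).2).

Definition replicas (c : placement) (w : 'I_K) : {set V} :=
  [set s | [exists j, c s j == w]].

Definition nearest (c : placement) (u : V) (w : 'I_K) : {set V} :=
  [set s in replicas c w |
    [forall s' in replicas c w, (gdist e u s <= gdist e u s')%N]].

(* Uniform choice in S; a request for a file cached nowhere (S empty) is
   unserved and adds to no load. *)
Definition choice_pmf (S : {set V}) (o : option V) : R :=
  if o is Some s then (s \in S)%:R / #|S|%:R else (S == finset.set0)%:R.

Definition assignment_pmf (c : placement) (r : requests) (a : assignment) : R :=
  \prod_i choice_pmf (nearest c (r i).1 (r i).2) (a i).

Definition outcome : finType := (placement * requests * assignment)%type.

Definition nearest_replica_pmf (w : outcome) : R :=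
  placement_pmf w.1.1 * requests_pmf w.1.2 * assignment_pmf w.1.1 w.1.2 w.2.

Definition Pr (E : pred outcome) : R := \sum_(w | E w) nearest_replica_pmf w.

Definition load (w : outcome) (s : V) : nat := #|[set i | w.2 i == Some s]|.

Definition max_load (w : outcome) : nat := (\max_s load w s)%N.

Lemma choice_pmf_sum1 (S : {set V}) : \sum_o choice_pmf S o = 1.
Proof.
rewrite (bigD1 None) //=.
rewrite (reindex_omap (@Some V) id) /=; last by case.
under eq_bigl do rewrite eqxx.
rewrite -mulr_suml -natr_sum -big_mkcond /= sum1_card.
case: eqVneq => [->|S0]; first by rewrite cards0 mul0r addr0.
by rewrite add0r divff // pnatr_eq0 cards_eq0.
Qed.

Lemma Pr_predT : (0 < #|V|)%N -> \sum_w p w = 1 -> Pr predT = 1.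
Proof.
move=> V0 p1; rewrite /Pr.
rewrite -(pair_bigA _ (fun cr a => nearest_replica_pmf (cr, a))) /=.
rewrite -(pair_bigA _ (fun c r => \sum_a nearest_replica_pmf (c, r, a))) /=.
under eq_bigr => c _.
  under eq_bigr => r _.
    rewrite /nearest_replica_pmf /= -mulr_sumr.
    rewrite [X in _ * X](_ : _ = 1) ?mulr1; last first.
      rewrite /assignment_pmf -(bigA_distr_bigA (fun i o =>
        choice_pmf (nearest c (r i).1 (r i).2) o)) /=.
      by rewrite big1 // => i _; exact: choice_pmf_sum1.
    over.
  rewrite -mulr_sumr [X in _ * X](_ : _ = 1) ?mulr1; last first.
    rewrite /requests_pmf -(bigA_distr_bigA (fun (i : 'I_q) (x : V * 'I_K) =>
      #|V|%:R^-1 * p x.2)) /=.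
    rewrite big1 // => i _.
    rewrite -(pair_bigA _ (fun (u : V) w => #|V|%:R^-1 * p w)) /=.
    under eq_bigr do rewrite -mulr_sumr p1 mulr1.
    by rewrite sumr_const -[LHS]mulr_natr mulVf // pnatr_eq0 -lt0n.
  over.
rewrite /placement_pmf -(bigA_distr_bigA (fun (s : V) (f : {ffun 'I_M -> 'I_K}) =>
  \prod_j p (f j))) /=.
rewrite big1 // => s _.
rewrite -(bigA_distr_bigA (fun (j : 'I_M) w => p w)) /=.
by rewrite big1.
Qed.

End CacheNetwork.

Definition uniform_popularity (R : realType) (K : nat) : 'I_K -> R :=
  fun=> K%:R^-1.
Arguments uniform_popularity R K : clear implicits.

(* Main.v *)
(** Given the placement, the requests are assigned independently with a common
    law Q on servers.  With probability at least 1 - 1/n every d x d square of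
    servers, with d^2 about 3 n ln n / M, contains a replica of every file; all
    Voronoi cells then have size O(n ln n / M), and since a server caches at
    most M files, Q(s) = O(ln n / n).  The exponential moment of a load gives
    the upper bound.  For the lower bound, apply the second-moment method to
    X = sum_s 'C(T_s, k) with T_s the load of s and k about ln n / (12 ln ln n):
    distinct servers are negatively correlated, so Var X <= (1 + O(ln n))^k E X
    up to a constant, while convexity of x^k gives E X >= n / k^k. *)

Require Import Defs.
From HB Require Import structures.
From mathcomp Require Import all_boot all_order all_algebra.
From mathcomp Require Import all_classical all_reals all_analysis.
From mathcomp Require Import ring lra zify.

Import Order.TTheory GRing.Theory Num.Theory.
Local Open Scope ring_scope.

(** * Independent identically distributed choices: tail bounds for the number of hits of a value *)

Section IidLoads.
Variables (R : realType) (I A : finType) (f : A -> R).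
Hypothesis f_ge0 : forall x, 0 <= f x.
Hypothesis f_sum1 : \sum_x f x = 1.

Lemma iid_sum1 : \sum_(a : {ffun I -> A}) \prod_i f (a i) = 1.
Proof.
by rewrite -(bigA_distr_bigA (fun _ => f)) big1.
Qed.

(** Chernoff's bound with parameter 1: the exponential moment of the load factors over the indices
    as [(1 + (e - 1) * f x) ^+ #|I|], which is at most the exponential of [(e - 1) * #|I| * f x]. *)
Lemma iid_load_tail (x : A) (b : R) :
  \sum_(a : {ffun I -> A} | b < #|[set i | a i == x]|%:R) \prod_i f (a i) <=
  expR ((expR 1 - 1) * (#|I|%:R * f x) - b).
Proof.
have e1 : 0 <= expR 1 - 1 :> R by have := expR_ge1Dx (1 : R); lra.
pose g (y : A) := f y * expR (y == x)%:R.
have gE : \sum_y g y = 1 + (expR 1 - 1) * f x.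
  have := f_sum1; rewrite (bigD1 x) //= => fE.
  rewrite (bigD1 x) //= (eq_bigr f); last first.
    by move=> y /negbTE yx; rewrite /g yx expR0 mulr1.
  by rewrite /g eqxx -{2}fE; ring.
apply: (@le_trans _ _ (expR (- b) * \sum_(a : {ffun I -> A}) \prod_i g (a i))).
  rewrite mulr_sumr big_mkcond /=; apply: ler_sum => a _.
  have g0 : 0 <= expR (- b) * \prod_i g (a i).
    by rewrite mulr_ge0 ?expR_ge0// prodr_ge0// => i _; rewrite mulr_ge0 ?expR_ge0.
  case: ifP => // bl; rewrite /g big_split /= -expR_sum -natr_sum.
  rewrite mulrCA -expRD ler_peMr ?prodr_ge0// -[leLHS]expR0 ler_expR.
  have -> : (\sum_i (a i == x) = #|[set i | a i == x]|)%N.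
    by rewrite -sum1dep_card [RHS]big_mkcond.
  by lra.
rewrite -(bigA_distr_bigA (fun _ => g)) prodr_const gE expRD mulrC.
rewrite ler_pM2r ?expR_gt0// mulrCA expRM_natl cardT -cardE.
rewrite lerXn2r ?nnegrE ?expR_ge0 ?expR_ge1Dx//.
by rewrite addr_ge0// mulr_ge0.
Qed.

(* Markov's inequality for the generating function
   [\sum_D p ^+ #|D :\: B| * x ^+ #|D|] at x = 1 / lam. *)
Lemma sum_draws_setD_le (B : {set I}) (k : nat) (p lam : R) :
  0 <= p -> 0 < lam -> #|I|%:R * p <= lam -> #|B| = k ->
  \sum_(D : {set I} | #|D| == k) p ^+ #|D :\: B| <= expR 1 * (1 + lam) ^+ k.
Proof.
move=> p0 l0 pl Bk.
pose h (i : I) := lam^-1 * (if i \in B then 1 else p).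
have h0 i : 0 <= h i by rewrite mulr_ge0 ?invr_ge0 ?(ltW l0)//; case: ifP.
have hD (D : {set I}) :
    \prod_i (if i \in D then h i else 1) = lam^-1 ^+ #|D| * p ^+ #|D :\: B|.
  rewrite -big_mkcond /= big_split /= prodr_const; congr (_ * _).
  rewrite (bigID (mem B)) /= big1 ?mul1r; last by move=> i /andP[_ ->].
  rewrite (eq_bigr (fun=> p)); last by move=> i /andP[_ /negbTE ->].
  rewrite -prodr_const; apply: eq_bigl => i.
  by rewrite !inE andbC.
apply: (@le_trans _ _ (lam ^+ k * \sum_(D : {set I})
    \prod_i (if i \in D then h i else 1))).
  rewrite mulr_sumr big_mkcond; apply: ler_sum => D _.
  case: ifP => [/eqP Dk|_].
    by rewrite hD mulrA Dk -exprMn divff ?gt_eqF// expr1n mul1r.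
  by rewrite mulr_ge0 ?exprn_ge0 ?(ltW l0)// prodr_ge0// => i _; case: ifP.
have -> : \sum_(D : {set I}) \prod_i (if i \in D then h i else 1) =
    \prod_i (h i + 1) by rewrite (bigA_distr 1%R).
(* The factors in [B] absorb [lam ^+ k] and give [(1 + lam) ^+ k]; those outside give at most
   [(1 + p / lam) ^+ #|I| <= e]. *)
rewrite (bigID (mem B)) /= mulrA mulrC.
rewrite ler_pM// ?prodr_ge0//.
- by move=> i _; rewrite addr_ge0.
- rewrite mulr_ge0 ?exprn_ge0 ?(ltW l0)// prodr_ge0// => i _; by rewrite addr_ge0.
- apply: (@le_trans _ _ (\prod_(i : I) expR (p / lam))).
    rewrite [leRHS](bigID (mem B)) /= -[leLHS]mul1r.
    rewrite ler_pM// ?prodr_ge0//.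
    + by move=> i _; rewrite addr_ge0.
    + rewrite -[leLHS](expr1n _ #|B|) -prodr_const ler_prod// => i _.
      by rewrite ler01 /= -[leLHS]expR0 ler_expR divr_ge0 // ltW.
    + apply: ler_prod => i iB; rewrite addr_ge0//= /h (negbTE iB).
      by rewrite addrC mulrC expR_ge1Dx.
  rewrite prodr_const -expRM_natl ler_expR mulrA ler_pdivrMr// mul1r.
  by rewrite cardT -cardE.
- rewrite (eq_bigr (fun=> lam^-1 + 1)); last by move=> i iB; rewrite /h iB mulr1.
  rewrite prodr_const Bk -exprMn mulrDr divff ?gt_eqF// mulr1.
  by rewrite lexx.
Qed.

(** Indicator of the event that all of [B] hits [x]. The factors 1 off [B] make it a product over
    all of [I], so that means can be computed one coordinate at a time. *)
Let cov_ind (a : {ffun I -> A}) (x : A) (B : {set I}) : R :=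
  \prod_i (if i \in B then (a i == x)%:R else 1).

Let cov_ind_mean (x : A) (B : {set I}) :
  \sum_(a : {ffun I -> A}) (\prod_i f (a i)) * cov_ind a x B = f x ^+ #|B|.
Proof.
pose F i y : R := f y * (if i \in B then (y == x)%:R else 1).
transitivity (\sum_(a : {ffun I -> A}) \prod_i F i (a i)).
  by apply: eq_bigr => a _; rewrite -big_split.
rewrite -(bigA_distr_bigA F) -prodr_const [RHS]big_mkcond /=.
apply: eq_bigr => i _; rewrite /F; case: ifP => _; last first.
  by rewrite -[RHS]f_sum1; apply: eq_bigr => y _; rewrite mulr1.
rewrite (bigD1 x) //= eqxx mulr1 big1 ?addr0// => y /negbTE ->.
by rewrite mulr0.
Qed.

(** For [x != y] no index hits both values: the mean vanishes if [B] and [D] meet and factors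
    otherwise, which is the negative correlation. For [x = y] the joint event is that the union of
    [B] and [D] hits [x]; splitting off [B] leaves an exponent that can be summed over [D]. *)
Let cov_ind_mean2 (x y : A) (B D : {set I}) :
  \sum_(a : {ffun I -> A}) (\prod_i f (a i)) * (cov_ind a x B * cov_ind a y D) <=
  f x ^+ #|B| * f y ^+ #|D| + (x == y)%:R * (f x ^+ #|B| * f x ^+ #|D :\: B|).
Proof.
case: eqVneq => [<-|xy].
  rewrite mul1r ler_wpDl//; first by rewrite mulr_ge0 ?exprn_ge0.
  rewrite -exprD (_ : #|B| + #|D :\: B| = #|B :|: D|)%N; last first.
    by rewrite -(cardsID B (B :|: D)) finset.setUK finset.setDUl finset.setDv finset.set0U.
  rewrite -cov_ind_mean; apply: ler_sum => a _; rewrite ler_wpM2l ?prodr_ge0//.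
  rewrite -big_split /=; apply: ler_prod => i _; rewrite inE.
  by case: (i \in B); case: (i \in D); case: eqP => _ /=; lra.
rewrite mul0r addr0 -!prodr_const.
pose F i z : R := f z *
  ((if i \in B then (z == x)%:R else 1) * (if i \in D then (z == y)%:R else 1)).
rewrite (eq_bigr (fun a : {ffun I -> A} => \prod_i F i (a i))); last first.
  by move=> a _; rewrite -!big_split.
rewrite -(bigA_distr_bigA F) ![\prod_(i in _) _]big_mkcond -big_split /=.
have mean1 z : \sum_t f t * (t == z)%:R = f z.
  rewrite (bigD1 z) //= eqxx mulr1 big1 ?addr0// => t /negbTE ->.
  by rewrite mulr0.
apply: ler_prod => i _; apply/andP; split.
  apply: sumr_ge0 => z _; rewrite mulr_ge0//.
  by case: ifP => _; case: ifP => _; rewrite ?mulr1 ?mul1r ?ler01 // -?natrM ler0n.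
rewrite /F; case: ifP => _; case: ifP => _.
- rewrite big1; first exact: mulr_ge0.
  move=> z _; case: (eqVneq z x) => [->|]; last by rewrite mul0r mulr0.
  by rewrite (negbTE xy) mulr0 mulr0.
- by rewrite mulr1 -[leRHS]mean1; apply: ler_sum => z _; rewrite mulr1.
- by rewrite mul1r -[leRHS]mean1; apply: ler_sum => z _; rewrite mul1r.
- by rewrite mulr1 -[leRHS]f_sum1; apply: ler_sum => z _; rewrite !mulr1.
Qed.

(** Chebyshev's inequality for the number of pairs of a value [x] in [S] and a [k]-set of indices
    all hitting [x]. If every load is below [k], this count is 0, hence at distance [mu] from its
    mean. *)
Lemma iid_max_load_tail (S : {set A}) (k : nat) (lam : R) :
  0 < lam -> (forall x, x \in S -> #|I|%:R * f x <= lam) ->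
  0 < 'C(#|I|, k)%:R * \sum_(x in S) f x ^+ k ->
  \sum_(a : {ffun I -> A} | [forall x in S, (#|[set i | a i == x]| < k)%N])
    \prod_i f (a i) <=
  expR 1 * (1 + lam) ^+ k / ('C(#|I|, k)%:R * \sum_(x in S) f x ^+ k).
Proof.
move=> l0 fl; set mu := _ * _ => mu0.
pose P (p : A * {set I}) := (p.1 \in S) && (#|p.2| == k).
(* This is the sum over [x] in [S] of the binomial coefficient of the load of [x] over [k]. *)
pose X (a : {ffun I -> A}) := \sum_(p | P p) cov_ind a p.1 p.2.
pose pr (a : {ffun I -> A}) := \prod_i f (a i).
have pr0 a : 0 <= pr a by exact: prodr_ge0.
have draws : \sum_(D : {set I} | #|D| == k) 1 = 'C(#|I|, k)%:R :> R.
  by rewrite -card_draws -sum1dep_card natr_sum.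
have muE : \sum_(p | P p) f p.1 ^+ k = mu.
  rewrite /P -(pair_big (mem S) (fun D : {set I} => #|D| == k)
    (fun x _ => f x ^+ k)) /= /mu mulr_sumr.
  apply: eq_bigr => x _; rewrite -draws mulr_suml.
  by apply: eq_bigr => D _; rewrite mul1r.
have EX : \sum_a pr a * X a = mu.
  under eq_bigr do rewrite mulr_sumr.
  rewrite exchange_big -muE; apply: eq_bigr => p /andP[_ /eqP <-].
  exact: cov_ind_mean.
have EX2 : \sum_a pr a * X a ^+ 2 <= mu ^+ 2 + expR 1 * (1 + lam) ^+ k * mu.
  have -> : \sum_a pr a * X a ^+ 2 =
      \sum_(p | P p) \sum_(q | P q) \sum_a
         pr a * (cov_ind a p.1 p.2 * cov_ind a q.1 q.2).
    under eq_bigr do rewrite expr2 mulr_suml mulr_sumr.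
    rewrite exchange_big; apply: eq_bigr => p _.
    under eq_bigr do rewrite mulr_sumr mulr_sumr.
    by rewrite exchange_big.
  apply: (@le_trans _ _ (\sum_(p | P p) (f p.1 ^+ k * mu +
     f p.1 ^+ k * (expR 1 * (1 + lam) ^+ k)))); last first.
    by rewrite big_split /= -!mulr_suml muE mulrC [mu * (_ * _)]mulrC.
  apply: ler_sum => -[x B] /andP[/= xS /eqP Bk].
  apply: (@le_trans _ _ (\sum_(q | P q) (f x ^+ k * f q.1 ^+ k +
      (x == q.1)%:R * (f x ^+ k * f x ^+ #|q.2 :\: B|)))).
    apply: ler_sum => -[y D] /andP[/= yS /eqP Dk].
    by rewrite -{1 3}Bk -{1}Dk; exact: cov_ind_mean2.
  rewrite big_split /= -mulr_sumr muE lerD2l.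
  under eq_bigr do rewrite mulrCA.
  rewrite -mulr_sumr ler_wpM2l ?exprn_ge0//.
  rewrite /P -(pair_big (mem S) (fun D : {set I} => #|D| == k)
    (fun y D => (x == y)%:R * f x ^+ #|D :\: B|)) /=.
  (* Only pairs with the same value [x] exceed the product of the means; their excess is
     [sum_draws_setD_le] with [p = f x]. *)
  rewrite (bigD1 x) //= [X in _ + X]big1 ?addr0; last first.
    by move=> y /andP[_ yx]; rewrite big1// => D _; rewrite eq_sym (negbTE yx) mul0r.
  under eq_bigr do rewrite eqxx mul1r.
  by apply: sum_draws_setD_le => //; exact: fl.
have Var : \sum_a pr a * (X a - mu) ^+ 2 <= expR 1 * (1 + lam) ^+ k * mu.
  have -> : \sum_a pr a * (X a - mu) ^+ 2 =
      \sum_a pr a * X a ^+ 2 - mu ^+ 2.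
    under eq_bigr => a _.
      rewrite (_ : _ * _ = pr a * X a ^+ 2 + (pr a * X a * (- mu *+ 2) +
        pr a * mu ^+ 2)); last by ring.
      over.
    rewrite !big_split /= -!mulr_suml EX iid_sum1; ring.
  by rewrite lerBlDl.
rewrite ler_pdivlMr// -(ler_pM2r mu0); apply: le_trans Var.
rewrite -mulrA mulr_suml big_mkcond; apply: ler_sum => a _.
case: ifPn => [small|_]; last by rewrite mulr_ge0 ?sqr_ge0.
suff -> : X a = 0 by rewrite sub0r sqrrN expr2 -/(pr a).
rewrite /X big1// => -[x B] /andP[/= xS /eqP Bk].
have := forall_inP small x xS; rewrite -Bk ltnNge => /negP ncard.
have /subsetPn[i iB ix] : ~~ (B \subset [set i | a i == x]).
  by apply/negP => /subset_leq_card.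
rewrite /cov_ind (bigD1 i) //= iB.
by move: ix; rewrite inE => /negbTE ->; rewrite mul0r.
Qed.

End IidLoads.

(** * Graph distance and paths *)

Section GraphDistanceTheory.
Variables (V : finType) (e : rel V).

Lemma gdist_le_path (u : V) (p : seq V) :
  path e u p -> (gdist e u (last u p) <= size p)%N.
Proof.
(* A path with [#|V|] or more edges is not among the candidates of the minimum, but the default
   value [#|V|] already bounds the distance. *)
move=> pp; case: (ltnP (size p) #|V|) => [sp|sp]; last first.
  by apply: leq_trans sp; rewrite /gdist -minEnat -leEnat bigmin_le_id.
rewrite /gdist -minEnat -leEnat.
apply: (bigmin_le_cond _ (j := Ordinal sp)).
by apply/existsP; exists (in_tuple p); rewrite pp eqxx.
Qed.

(** The bound [r < #|V|] rules out the default value of the distance, so the minimum is attained by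
    an actual path. *)
Lemma gdist_path_exists (u v : V) (r : nat) :
  (gdist e u v <= r)%N -> (r < #|V|)%N ->
  exists p, [/\ path e u p, last u p = v & (size p <= r)%N].
Proof.
move=> dr rV.
suff : (gdist e u v < #|V|)%N ->
    exists p, [/\ path e u p, last u p = v & size p = gdist e u v].
  by case=> [|p [? ? sp]]; [exact: leq_ltn_trans rV|exists p; rewrite sp].
rewrite /gdist; elim/big_ind: _ => [|x y Hx Hy|k /existsP[p /andP[pp /eqP lp]] _].
- by rewrite ltnn.
- by rewrite /minn; case: ifP.
- by exists p; rewrite pp lp size_tuple.
Qed.

End GraphDistanceTheory.

(** * Squares and balls on the torus *)

Section TorusBalls.
Local Open Scope nat_scope.
Variable m : nat.
Implicit Types u v s : 'I_m * 'I_m.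

(** The square with corner [u], extending in the positive directions with wrap-around. *)
Definition torus_square (k : nat) (u : 'I_m * 'I_m) : {set 'I_m * 'I_m} :=
  [set (iter p.1 (@ordS m) u.1, iter p.2 (@ordS m) u.2) | p : 'I_k * 'I_k].

Lemma val_iter_ordS (i : nat) (x : 'I_m) : iter i (@ordS m) x = (x + i) %% m :> nat.
Proof.
elim: i => [|i IHi]; first by rewrite addn0 modn_small.
by rewrite iterS /= IHi -addn1 modnDml addn1 addnS.
Qed.

Lemma ordS_neq (x : 'I_m) : (1 < m)%N -> ordS x != x.
Proof.
move=> m1; apply/eqP => /(congr1 val) /=.
have := ltn_ord x; rewrite leq_eqVlt => /orP[/eqP xm|xm].
  by rewrite xm modnn; lia.
by rewrite modn_small//; lia.
Qed.

Lemma card_torus_square (k : nat) u : (k <= m)%N -> #|torus_square k u| = (k ^ 2)%N.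
Proof.
move=> km; rewrite card_imset; first by rewrite card_prod card_ord mulnn.
have inj (x : 'I_m) (i j : 'I_k) :
    iter i (@ordS m) x = iter j (@ordS m) x -> i = j.
  move=> /(congr1 val) /=; rewrite !val_iter_ordS => /eqP.
  rewrite eqn_modDl !modn_small ?(leq_trans (ltn_ord _) km)//.
  by move=> /eqP/val_inj.
by move=> [i1 j1] [i2 j2] [] /inj -> /inj ->.
Qed.

Lemma gdist_torus_square (k : nat) u v : (1 < m)%N ->
  v \in torus_square k u -> (gdist (@torus_adj m) u v <= 2 * k)%N.
Proof.
move=> m1 /imsetP[[i j] _ ->] /=.
pose f1 (w : 'I_m * 'I_m) := (ordS w.1, w.2).
pose f2 (w : 'I_m * 'I_m) := (w.1, ordS w.2).
pose p := traject f1 (f1 u) i ++ traject f2 (f2 (iter i f1 u)) j.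
have f1E n w : iter n f1 w = (iter n (@ordS m) w.1, w.2).
  by elim: n => [|n /= ->//]; case: w.
have f2E n w : iter n f2 w = (w.1, iter n (@ordS m) w.2).
  by elim: n => [|n /= ->//]; case: w.
have adj1 : subrel (frel f1) (@torus_adj m).
  move=> x _ /= /eqP <-; rewrite /torus_adj /cycle_adj /= !eqxx /= orbT andbT.
  by apply/eqP => /(congr1 fst)/eqP /=; rewrite eq_sym (negbTE (ordS_neq _ _)).
have adj2 : subrel (frel f2) (@torus_adj m).
  move=> x _ /= /eqP <-; rewrite /torus_adj /cycle_adj /= !eqxx /= andbT.
  by apply/eqP => /(congr1 snd)/eqP /=; rewrite eq_sym (negbTE (ordS_neq _ _)).
have -> : (iter i (@ordS m) u.1, iter j (@ordS m) u.2) = last u p.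
  by rewrite last_cat !last_traject f2E f1E.
apply: (leq_trans (gdist_le_path _ _ _ _ _)).
  rewrite cat_path last_traject.
  rewrite (sub_path adj1) ?fpath_traject// (sub_path adj2) ?fpath_traject//.
rewrite size_cat !size_traject; have := ltn_ord i; have := ltn_ord j; lia.
Qed.

(* y - x lies in [-r, r] modulo m; adding r avoids truncated subtraction. *)
Definition cyclic_near (r : nat) (x y : 'I_m) : Prop :=
  exists i : 'I_(2 * r).+1, y + r = x + i %[mod m].

Lemma cyclic_near_step (r : nat) (x y z : 'I_m) :
  cyclic_near r x y -> (y = z) \/ cycle_adj y z -> cyclic_near r.+1 x z.
Proof.
move=> [i yx] yz.
(* Offsets are recentred when [r] grows by one: standing still adds 1, a forward step 2, a backward
   step 0. *)
suff [d d2 zy] : exists2 d, (d <= 2)%N & z + r.+1 = y + r + d %[mod m].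
  have id : (i + d < (2 * r.+1).+1)%N by have := ltn_ord i; lia.
  exists (Ordinal id) => /=.
  by rewrite zy -modnDml yx modnDml addnA.
case: yz => [<-|/orP[]/eqP ->].
- by exists 1%N; rewrite // addnS addn1.
- exists 2; rewrite //= modnDml; congr (_ %% _); lia.
- exists 0%N; rewrite //= addn0 modnDml; congr (_ %% _); lia.
Qed.

Lemma torus_path_near (p : seq ('I_m * 'I_m)) u :
  path (@torus_adj m) u p ->
  cyclic_near (size p) u.1 (last u p).1 /\ cyclic_near (size p) u.2 (last u p).2.
Proof.
elim/last_ind: p => [|p v IHp]; first by move=> _; split; exists ord0.
rewrite rcons_path last_rcons size_rcons => /andP[/IHp[n1 n2] /andP[_]].
case/orP => /andP[/eqP eqv adj]; split.
- by apply: cyclic_near_step n1 _; left.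
- by apply: cyclic_near_step n2 _; right.
- by apply: cyclic_near_step n1 _; right.
- by apply: cyclic_near_step n2 _; left.
Qed.

Lemma cyclic_near_mono (r r' : nat) (x y : 'I_m) : (r <= r')%N ->
  cyclic_near r x y -> cyclic_near r' x y.
Proof.
move=> rr n; rewrite -(subnKC rr); elim: (r' - r)%N => [|d IHd].
  by rewrite addn0.
by rewrite addnS; apply: cyclic_near_step IHd _; left.
Qed.

(** A vertex [u] within distance [r] of [s] is determined by its two cyclic offsets to [s], each
    with [2 * r + 1] possible values. *)
Lemma card_torus_ball (r : nat) s :
  (#|[set u | (gdist (@torus_adj m) u s <= r)%N]| <= (2 * r).+1 ^ 2)%N.
Proof.
set S := [set u | _].
case: (ltnP r #|{: 'I_m * 'I_m}|) => [rV|Vr]; last first.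
  by apply: leq_trans (max_card _) _; apply: leq_trans Vr _; nia.
have Snear u : u \in S ->
    {q : 'I_(2 * r).+1 * 'I_(2 * r).+1 |
      s.1 + r = u.1 + q.1 %[mod m] /\ s.2 + r = u.2 + q.2 %[mod m]}.
  rewrite inE => dr; apply: cid.
  have [p [/torus_path_near[n1 n2] lp sp]] := gdist_path_exists _ _ _ _ _ dr rV.
  rewrite lp in n1 n2.
  have [i1 H1] := cyclic_near_mono _ _ _ _ sp n1.
  have [i2 H2] := cyclic_near_mono _ _ _ _ sp n2.
  by exists (i1, i2).
pose g u := if pselect (u \in S) is left uS then sval (Snear u uS) else (ord0, ord0).
have mod_inj (x y : 'I_m) (i : nat) : x + i = y + i %[mod m] -> x = y.
  move=> /eqP; rewrite eqn_modDr !modn_small// => /eqP; exact: val_inj.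
rewrite -(@card_in_imset _ _ g); last first.
  move=> u v; rewrite /g; case: pselect => // uS _; case: pselect => // vS _.
  case: (Snear u uS) => q [q1 q2]; case: (Snear v vS) => q' [q1' q2'] /= qq.
  rewrite -qq in q1' q2'.
  rewrite [u]surjective_pairing [v]surjective_pairing.
  by congr pair; [apply: (mod_inj _ _ q.1); rewrite -q1 q1'|apply: (mod_inj _ _ q.2); rewrite -q2 q2'].
by apply: leq_trans (max_card _) _; rewrite card_prod !card_ord mulnn.
Qed.

End TorusBalls.

(** * The law of the assignments given the placement *)

Section ConditionalLaw.
Variables (R : realType) (V : finType) (e : rel V).
Variables (K : nat) (p : 'I_K -> R) (M q : nat).
Hypothesis V_gt0 : (0 < #|V|)%N.
Hypothesis p_ge0 : forall w, 0 <= p w.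
Hypothesis p_sum1 : \sum_w p w = 1.

(** The law [Q] of the server of a single request for a fixed placement, averaged over origin, file
    and tie-breaking; [None] carries the probability of being unserved. *)
Definition assigned_law (c : placement V K M) (o : option V) : R :=
  \sum_(x : V * 'I_K) (#|V|%:R^-1 * p x.2) * choice_pmf R (nearest e c x.1 x.2) o.

Lemma choice_pmf_ge0 (S : {set V}) (o : option V) : 0 <= choice_pmf R S o.
Proof. by case: o => [s|] /=; rewrite ?divr_ge0. Qed.

Lemma origin_file_sum1 : \sum_(x : V * 'I_K) (#|V|%:R^-1 * p x.2) = 1.
Proof.
rewrite -(pair_bigA _ (fun (u : V) w => #|V|%:R^-1 * p w)) /=.
under eq_bigr do rewrite -mulr_sumr p_sum1 mulr1.
by rewrite sumr_const -[LHS]mulr_natr mulVf // pnatr_eq0 -lt0n.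
Qed.

Lemma assigned_law_ge0 (c : placement V K M) (o : option V) : 0 <= assigned_law c o.
Proof.
by apply: sumr_ge0 => x _; rewrite mulr_ge0 ?choice_pmf_ge0// mulr_ge0 ?invr_ge0.
Qed.

Lemma assigned_law_sum1 (c : placement V K M) : \sum_o assigned_law c o = 1.
Proof.
rewrite /assigned_law exchange_big -[RHS]origin_file_sum1.
by apply: eq_bigr => x _; rewrite -mulr_sumr choice_pmf_sum1 mulr1.
Qed.

Lemma placement_pmf_ge0 (c : placement V K M) : 0 <= placement_pmf p c.
Proof. by apply: prodr_ge0 => s _; apply: prodr_ge0. Qed.

Lemma placement_pmf_sum1 : \sum_(c : placement V K M) placement_pmf p c = 1.
Proof.
rewrite /placement_pmf -(bigA_distr_bigA (fun (s : V) (f : {ffun 'I_M -> 'I_K}) =>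
  \prod_j p (f j))) /= big1 // => s _.
by rewrite -(bigA_distr_bigA (fun (j : 'I_M) w => p w)) /= big1.
Qed.

(** Given the placement, origins, files and tie-breaks are independent across requests, so summing
    out the requests turns the weight of an assignment into a product of [assigned_law]. *)
Lemma Pr_assignment (F : pred (assignment V q)) :
  Pr e p (fun w : outcome V K M q => F w.2) =
  \sum_c placement_pmf p c * \sum_(a | F a) \prod_i assigned_law c (a i).
Proof.
rewrite /Pr big_mkcond /=.
rewrite -(pair_bigA _ (fun cr a => if F a then nearest_replica_pmf e p (cr, a) else 0)) /=.
rewrite -(pair_bigA _ (fun c r => \sum_a if F a then nearest_replica_pmf e p (c, r, a) else 0)) /=.
apply: eq_bigr => c _; rewrite exchange_big mulr_sumr [RHS]big_mkcond /=.
apply: eq_bigr => a _; case: ifP => _; last by rewrite big1.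
rewrite /nearest_replica_pmf /=.
under eq_bigr do rewrite -mulrA.
rewrite -mulr_sumr; congr (_ * _).
rewrite /assigned_law (bigA_distr_bigA (fun i (x : V * 'I_K) =>
  (#|V|%:R^-1 * p x.2) * choice_pmf R (nearest e c x.1 x.2) (a i))).
by apply: eq_bigr => r _; rewrite big_split.
Qed.

(** All [M * #|S|] independent cache slots in [S] must avoid [w]. *)
Lemma placement_miss_le (S : {set V}) (w : 'I_K) :
  \sum_(c : placement V K M | [disjoint replicas c w & S]) placement_pmf p c <=
  (1 - p w) ^+ (M * #|S|).
Proof.
pose g (s : V) x := p x * (if s \in S then (x != w)%:R else 1).
have g0 s x : 0 <= g s x by rewrite mulr_ge0//; case: ifP.
have -> : (1 - p w) ^+ (M * #|S|) =
    \sum_(c : placement V K M) \prod_s \prod_j g s (c s j).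
  rewrite -(bigA_distr_bigA (fun s (f : {ffun 'I_M -> 'I_K}) => \prod_j g s (f j))).
  rewrite exprM -prodr_const big_mkcond /=; apply: eq_bigr => s _.
  rewrite -(bigA_distr_bigA (fun j x => g s x)) /= prodr_const card_ord /g.
  case: ifP => _; last first.
    by under eq_bigr do rewrite mulr1; rewrite p_sum1 expr1n.
  congr (_ ^+ _); have -> : 1 - p w = \sum_(i | i != w) p i.
    by rewrite -p_sum1 (bigD1 w) //= addrAC subrr add0r.
  rewrite [RHS](bigD1 w) //= eqxx mulr0 add0r.
  by apply: eq_bigr => x ->; rewrite mulr1.
rewrite big_mkcond; apply: ler_sum => c _; case: ifP => [dis|_]; last first.
  by apply: prodr_ge0 => s _; apply: prodr_ge0.
suff -> : placement_pmf p c = \prod_s \prod_j g s (c s j) by exact: lexx.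
apply: eq_bigr => s _; apply: eq_bigr => j _; rewrite /g.
case: ifP => [sS|_]; last by rewrite mulr1.
have /negP : s \notin replicas c w.
  by apply/negP => sr; move: dis => /pred0P/(_ s); rewrite /= sr sS.
case: eqP => [cw|_ _]; last by rewrite mulr1.
by case; rewrite inE; apply/existsP; exists j; rewrite cw.
Qed.

Definition covered (S : V -> {set V}) (c : placement V K M) :=
  [forall u, forall w, ~~ [disjoint replicas c w & S u]].

(** Union bound over the pairs of a vertex and a file. *)
Lemma not_covered_le (S : V -> {set V}) (d : nat) (b : R) :
  (forall u, #|S u| = d) -> (forall w, (1 - p w) ^+ (M * d) <= b) ->
  \sum_(c | ~~ covered S c) placement_pmf p c <= #|V|%:R * K%:R * b.
Proof.
move=> Sd pb.
apply: (@le_trans _ _ (\sum_(x : V * 'I_K)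
    \sum_(c | [disjoint replicas c x.2 & S x.1]) placement_pmf p c)); last first.
  apply: (@le_trans _ _ (\sum_(x : V * 'I_K) b)).
    by apply: ler_sum => x _; apply: le_trans (placement_miss_le _ _) _; rewrite Sd.
  by rewrite sumr_const card_prod card_ord -[leLHS]mulr_natl natrM.
under [leRHS]eq_bigr do rewrite big_mkcond.
rewrite exchange_big big_mkcond; apply: ler_sum => c _ /=.
have term0 x : 0 <= if [disjoint replicas c x.2 & S x.1] then placement_pmf p c else 0.
  by case: ifP => // _; exact: placement_pmf_ge0.
case: ifP => [|_]; last exact: sumr_ge0.
move=> /forallPn[u /forallPn[w]]; rewrite negbK => dis.
by rewrite (bigD1 (u, w)) //= dis lerDl sumr_ge0.
Qed.

Lemma assigned_law_None (S : V -> {set V}) (c : placement V K M) :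
  covered S c -> assigned_law c None = 0.
Proof.
move=> cov; apply: big1 => -[u w] _ /=.
have /forallP/(_ w) := forallP cov u.
rewrite -setI_eq0 => /set0Pn[s]; rewrite inE => /andP[sr _].
rewrite (_ : _ == _ = false) ?mulr0//; apply/negbTE/set0Pn.
case: (arg_minnP (gdist e u) sr) => t tr tmin.
by exists t; rewrite inE; apply/andP; split; [exact: tr|exact/forall_inP].
Qed.

(** Coverage puts a replica within [r] of every origin, so a request reaches [s] only from the ball
    of radius [r] around [s], and only for one of the at most [M] files cached at [s]. *)
Lemma assigned_law_Some_le (S : V -> {set V}) (c : placement V K M) (r b : nat)
    (pmax : R) (s : V) :
  0 <= pmax -> (forall w, p w <= pmax) ->
  (forall u t, t \in S u -> gdist e u t <= r)%N ->
  (#|[set u | (gdist e u s <= r)%N]| <= b)%N ->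
  covered S c ->
  assigned_law c (Some s) <= #|V|%:R^-1 * pmax * (b * M)%:R.
Proof.
move=> pmax0 ppmax Sr sb cov.
pose B := [set u | (gdist e u s <= r)%N].
pose C := [set w | [exists j, c s j == w]].
have CM : (#|C| <= M)%N.
  rewrite -[leqRHS]card_ord.
  apply: leq_trans _ (leq_imset_card (c s) 'I_M).
  apply/subset_leq_card/fintype.subsetP => w.
  by rewrite inE => /existsP[j /eqP <-]; exact: imset_f.
have chB u w : choice_pmf R (nearest e c u w) (Some s) <= ((u \in B) && (w \in C))%:R.
  rewrite /=; case: (boolP (s \in nearest e c u w)) => [sn|_]; last by rewrite mul0r.
  have uB : u \in B.
    have /forallP/(_ w) := forallP cov u.
    rewrite -setI_eq0 => /set0Pn[t]; rewrite inE => /andP[tr tS].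
    rewrite inE; move: sn; rewrite inE => /andP[_ /forall_inP/(_ t tr)].
    by move=> /leq_trans; apply; exact: Sr.
  have wC : w \in C by move: sn; rewrite !inE => /andP[].
  rewrite uB wC /= mul1r invf_le1 ?ltr0n ?ler1n; last first.
    by apply/card_gt0P; exists s.
  by apply/card_gt0P; exists s.
apply: (@le_trans _ _ (\sum_(x : V * 'I_K | (x.1 \in B) && (x.2 \in C)) #|V|%:R^-1 * pmax)).
  rewrite [leRHS]big_mkcond; apply: ler_sum => -[u w] _ /=.
  apply: le_trans (ler_wpM2l _ (chB u w)) _; first by rewrite mulr_ge0 ?invr_ge0.
  case: ifP => _; last by rewrite mulr0.
  by rewrite mulr1 ler_wpM2l ?invr_ge0.
rewrite -(pair_big (mem B) (mem C) (fun _ _ => #|V|%:R^-1 * pmax)) /= !sumr_const.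
rewrite -mulrnA -[leLHS]mulr_natr ler_wpM2l ?mulr_ge0 ?invr_ge0//.
by rewrite ler_nat mulnC leq_mul.
Qed.

End ConditionalLaw.

(** * Maximum load when balls are thrown into bins with a nearly uniform law *)

Lemma expn_le_bin (n k : nat) : (k <= n -> n ^ k <= 'C(n, k) * k ^ k)%N.
Proof.
elim: k n => [|k IHk] n; first by rewrite bin0.
case: n => // n kn.
have [k0|k0] := posnP k; first by rewrite k0 bin1 expn1 muln1.
rewrite !expnS mulnA [X in (_ <= X * _)%N]mulnC -mul_bin_diag -mulnA leq_pmul2l//=.
have kk0 : (0 < k ^ k)%N by rewrite expn_gt0 k0.
rewrite -(leq_pmul2r kk0) mulnAC -expnMn.
(* Here [n.+1 * k <= n * k.+1] amounts to [k <= n]. *)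
apply: (@leq_trans ((n * k.+1) ^ k)); first by rewrite leq_exp2r//; nia.
by rewrite expnMn leq_pmul2r ?expn_gt0// IHk.
Qed.

Lemma bernoulli_tangent (R : realFieldType) (y : R) (k : nat) :
  0 <= y -> 1 + k%:R * (y - 1) <= y ^+ k.
Proof.
move=> y0; elim: k => [|k IHk]; first by rewrite mul0r addr0 expr0.
rewrite exprSr; apply: le_trans (ler_wpM2r y0 IHk).
have : 0 <= k%:R * (y - 1) ^+ 2 by rewrite mulr_ge0 ?sqr_ge0.
by rewrite -natr1; nra.
Qed.

(** Convexity of the [k]-th power: after scaling by [#|S|] the mean of [f] is 1, and the linear
    terms of the tangent at 1 sum to zero. *)
Lemma sum_expr_ge (R : realFieldType) (A : finType) (S : {set A}) (f : A -> R) (k : nat) :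
  (forall x, 0 <= f x) -> \sum_(x in S) f x = 1 -> (0 < #|S|)%N ->
  #|S|%:R / #|S|%:R ^+ k <= \sum_(x in S) f x ^+ k.
Proof.
move=> f0 f1 S0; set n : R := #|S|%:R.
have n0 : 0 < n by rewrite ltr0n.
rewrite ler_pdivrMr ?exprn_gt0// mulr_suml.
apply: (@le_trans _ _ (\sum_(x in S) (1 + k%:R * (f x * n - 1)))); last first.
  by apply: ler_sum => x _; rewrite -exprMn bernoulli_tangent// mulr_ge0// ltW.
rewrite big_split /= -mulr_sumr sumrB -mulr_suml f1 !sumr_const -/n.
by rewrite mul1r subrr mulr0 addr0.
Qed.

(** The first error term is a union bound over the [n] servers of the Chernoff tail above [b]; the
    second is the Chebyshev bound for all loads being below [k]. *)
Lemma balls_in_bins (R : realType) (V : finType) (f : option V -> R) (n k : nat) (lam b : R) :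
  #|V| = n -> (0 < n)%N -> (0 < k <= n)%N -> 0 < lam ->
  (forall o, 0 <= f o) -> \sum_o f o = 1 -> f None = 0 ->
  (forall s, n%:R * f (Some s) <= lam) ->
  1 - (n%:R * expR ((expR 1 - 1) * lam - b) +
       expR 1 * ((1 + lam) * k%:R) ^+ k / n%:R) <=
  \sum_(a : {ffun 'I_n -> option V} |
      [exists s, (k <= #|[set i | a i == Some s]|)%N] &&
      [forall s, #|[set i | a i == Some s]|%:R <= b]) \prod_i f (a i).
Proof.
move=> Vn n0 /andP[k0 kn] l0 f0 f1 fN fS.
have n0' : 0 < n%:R :> R by rewrite ltr0n.
pose pr (a : {ffun 'I_n -> option V}) := \prod_i f (a i).
have pr0 a : 0 <= pr a by exact: prodr_ge0.
pose ld (a : {ffun 'I_n -> option V}) s := #|[set i | a i == Some s]|.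
pose S : {set option V} := [set~ None].
have cardS : #|S| = n by rewrite cardsC1 card_option Vn.
have fSum : \sum_(x in S) f x = 1.
  rewrite -f1 [RHS](bigD1 None) //= fN add0r.
  by apply: eq_bigl => x; rewrite !inE.
(* Convexity gives at least [n / n ^ k] for the sum, and the binomial coefficient is at least
   [(n / k) ^ k]. *)
have mu_ge : n%:R / k%:R ^+ k <= 'C(#|'I_n|, k)%:R * \sum_(x in S) f x ^+ k.
  apply: (@le_trans _ _ ('C(n, k)%:R * (n%:R / n%:R ^+ k))); last first.
    rewrite card_ord ler_wpM2l//.
    by have := @sum_expr_ge _ _ S f k f0 fSum; rewrite cardS; apply.
  have k0' : 0 < k%:R :> R by rewrite ltr0n.
  rewrite mulrCA ler_wpM2l ?ler0n// ler_pdivlMr ?exprn_gt0// mulrC.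
  by rewrite ler_pdivrMr ?exprn_gt0// -!natrX -natrM ler_nat expn_le_bin.
have mu0 : 0 < 'C(#|'I_n|, k)%:R * \sum_(x in S) f x ^+ k.
  by apply: lt_le_trans mu_ge; rewrite divr_gt0// exprn_gt0// ltr0n.
have low : \sum_(a | ~~ [exists s, (k <= ld a s)%N]) pr a <=
    expR 1 * ((1 + lam) * k%:R) ^+ k / n%:R.
  have fS' x : x \in S -> #|'I_n|%:R * f x <= lam.
    by rewrite card_ord; case: x => [s|] //; rewrite !inE.
  have := iid_max_load_tail _ _ _ _ f0 f1 _ _ _ l0 fS' mu0.
  rewrite (eq_bigl (fun a => ~~ [exists s, (k <= ld a s)%N])); last first.
    move=> a; apply/forall_inP/existsPn => H.
      by move=> s; rewrite -ltnNge H// !inE.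
    by move=> [s|]; rewrite !inE// => _; have := H s; rewrite -ltnNge.
  move=> /le_trans; apply; rewrite exprMn -!mulrA.
  rewrite !ler_wpM2l ?expR_ge0// ?exprn_ge0 ?addr_ge0 ?(ltW l0)//.
  rewrite -[leRHS]invf_div lef_pV2 ?posrE// divr_gt0// exprn_gt0// ltr0n//.
have high : \sum_(a | ~~ [forall s, (ld a s)%:R <= b]) pr a <=
    n%:R * expR ((expR 1 - 1) * lam - b).
  apply: (@le_trans _ _ (\sum_s \sum_(a | b < (ld a s)%:R) pr a)).
    under [leRHS]eq_bigr do rewrite big_mkcond.
    rewrite exchange_big big_mkcond; apply: ler_sum => a _ /=.
    have t0 s : 0 <= if b < (ld a s)%:R then pr a else 0 by case: ifP.
    case: ifP => [|_]; last exact: sumr_ge0.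
    by case/forallPn => s; rewrite -ltNge => bs; rewrite (bigD1 s) //= bs lerDl sumr_ge0.
  rewrite -[in leRHS]Vn mulr_natl -sumr_const; apply: ler_sum => s _.
  apply: le_trans (iid_load_tail _ _ _ _ f0 f1 (Some s) b) _.
  rewrite ler_expR lerD2r ler_wpM2l//; last by rewrite card_ord.
have total : \sum_a pr a = 1 by exact: (iid_sum1 _ _ _ f f1).
rewrite lerBlDr -[leLHS]total.
apply: le_trans _ (lerD (lexx _) (lerD high low)).
rewrite [X in _ <= X + _]big_mkcond [X in _ <= _ + (X + _)]big_mkcond.
rewrite [X in _ <= _ + (_ + X)]big_mkcond -!big_split /=; apply: ler_sum => a _.
have := pr0 a; rewrite -/(pr a).
case: [exists s, (k <= ld a s)%N]; case: [forall s, (ld a s)%:R <= b] => /=.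
all: lra.
Qed.

(** * Numerical choice of the square side and of the load threshold *)

Lemma sqr_le_4expR (R : realType) (x : R) : 0 <= x -> x ^+ 2 <= 4 * expR x.
Proof.
move=> x0; rewrite (_ : x = x / 2 + x / 2); last by lra.
by rewrite expRD; have := expR_ge1Dx (x / 2); nra.
Qed.

(** Rounding up [y], the root of [3 * n * L / M], at most doubles it since [y >= 1], whence the
    factor 12 = 3 * 4. The hypothesis [12 * L <= M] then makes the square fit into the torus. *)
Lemma square_side (R : realType) (n : nat) (M L : R) :
  0 < L -> 0 < M -> 12 * L <= M -> M <= 3 * n%:R * L ->
  exists d : nat, [/\ (d ^ 2 <= n)%N, 3 * n%:R * L <= M * (d ^ 2)%:R &
    M * (d ^ 2)%:R <= 12 * n%:R * L].
Proof.
move=> L0 M0 LM ML.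
have x1 : 1 <= 3 * n%:R * L / M by rewrite ler_pdivlMr// mul1r.
have y1 : 1 <= Num.sqrt (3 * n%:R * L / M).
  by rewrite -[leLHS]sqrtr1 ler_sqrt// (le_trans ler01).
set y := Num.sqrt _ in y1.
have yE : M * y ^+ 2 = 3 * n%:R * L.
  by rewrite sqr_sqrtr ?(le_trans ler01)// mulrC divfK// gt_eqF.
have y0 : 0 <= y by lra.
have /andP[ty yt] := truncn_itv y0.
exists (Num.trunc y).+1; set d : R := (Num.trunc y).+1%:R.
have d2 : d <= 2 * y by rewrite /d -natr1; lra.
have dd : M * (2 * y) ^+ 2 = 12 * n%:R * L by rewrite exprMn mulrCA yE; ring.
have dy : M * d ^+ 2 <= 12 * n%:R * L.
  by rewrite -dd ler_wpM2l ?(ltW M0)// lerXn2r ?nnegrE// mulr_ge0.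
rewrite natrX; split => //.
- rewrite -(ler_nat R) natrX -(ler_pM2l M0); apply: (le_trans dy).
  by have := ler0n R n; nra.
- by rewrite -yE ler_wpM2l ?(ltW M0)// lerXn2r ?nnegrE ?(ltW yt).
Qed.

Lemma load_threshold (R : realType) (L : R) : 1 <= L -> 100 <= ln L ->
  exists k : nat, [/\ (0 < k)%N, L / (12 * ln L) <= k%:R, k%:R <= L &
    expR 1 * ((1 + 300 * L) * k%:R) ^+ k <= expR (L / 2)].
Proof.
move=> L1 lL; have L0 : 0 < L by lra.
have LE : expR (ln L) = L by rewrite lnK.
set l := ln L in lL LE *.
have l2 : l ^+ 2 <= 4 * L by rewrite -LE sqr_le_4expR//; lra.
have l0 : 0 < l by lra.
pose y := L / (12 * l); have yl : y * (12 * l) = L by rewrite divfK// gt_eqF//; lra.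
have y0 : 0 <= y by rewrite divr_ge0; lra.
have /andP[ty yt] := truncn_itv y0.
exists (Num.trunc y).+1; set k := (Num.trunc y).+1.
have ky : k%:R <= y + 1 by rewrite /k -natr1; lra.
have kL : k%:R <= L by apply: (le_trans ky); nra.
split => //; first by rewrite ltW.
(* The base is at most [L ^ 3], by [301 <= L] and [k <= L]. The exponent becomes
   [1 + 3 * l * k <= 1 + L / 4 + 3 * l], and [l ^ 2 <= 4 * L] with [l >= 100] brings it below
   [L / 2]. *)
have base : (1 + 300 * L) * k%:R <= expR (3 * l).
  rewrite -[3]/(3%:R) expRM_natl LE.
  have : 0 <= k%:R :> R by [].
  have : 301 <= L by nra.
  by rewrite 2!exprS expr1; nra.
apply: (@le_trans _ _ (expR 1 * expR (3 * l) ^+ k)).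
  by rewrite ler_wpM2l ?expR_ge0// lerXn2r ?nnegrE ?expR_ge0// mulr_ge0// addr_ge0; lra.
by rewrite -expRM_natl -expRD ler_expR; nra.
Qed.

Lemma one_sub_inv_exp_le (R : realType) (n j : nat) (L : R) :
  (0 < n)%N -> 3 * n%:R * L <= j%:R ->
  (1 - n%:R^-1) ^+ j <= expR (- (3 * L)) :> R.
Proof.
move=> n0 nj; have n0' : 0 < n%:R :> R by rewrite ltr0n.
apply: (@le_trans _ _ (expR (- n%:R^-1) ^+ j)).
  rewrite lerXn2r ?nnegrE ?expR_ge0 ?expR_ge1Dx//.
  by rewrite subr_ge0 invf_le1// ler1n.
rewrite -expRM_natl ler_expR mulrN lerN2 ler_pdivlMr//.
by rewrite mulrAC.
Qed.

(** * Load bounds for a fixed torus size *)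

(** The three error terms come from placements that are not covered, from the upper tail of the
    loads, and from the second-moment bound. *)
Lemma max_load_bounds (R : realType) (m M k : nat) (c2 L : R) :
  let n := (m ^ 2)%N in
  (1 < m)%N -> L = ln n%:R -> c2 = 300 * (expR 1 - 1) + 2 ->
  0 < L -> 12 * L <= M%:R -> M%:R <= 3 * n%:R * L ->
  (0 < k)%N -> k%:R <= L ->
  expR 1 * ((1 + 300 * L) * k%:R) ^+ k <= expR (L / 2) ->
  1 - (expR (- L) + expR (- L) + expR (- (L / 2))) <=
    Pr (@torus_adj m) (uniform_popularity R n)
      (fun w : outcome ('I_m * 'I_m)%type n M n =>
        (k <= max_load w)%N && ((max_load w)%:R <= c2 * L)).
Proof.
move=> n m1 LE c2E L0 LM ML k0 kL klow.
have n0 : (0 < n)%N by rewrite expn_gt0; lia.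
have n0' : 0 < n%:R :> R by rewrite ltr0n.
have nE : n%:R = expR L by rewrite LE lnK// posrE.
have cardV : #|{: 'I_m * 'I_m}| = n by rewrite card_prod card_ord mulnn.
have V0 : (0 < #|{: 'I_m * 'I_m}|)%N by rewrite cardV.
have M0 : 0 < M%:R :> R by lra.
have [d [dn dM Md]] := square_side R n M%:R L L0 M0 LM ML.
have dm : (d <= m)%N by rewrite -leq_sqr.
have d0 : (0 < d)%N.
  case: d dM {dn Md dm} => // dM.
  by have := mulr_gt0 n0' L0; move: dM; rewrite mulr0; lra.
have p0 w : 0 <= uniform_popularity R n w by rewrite invr_ge0.
have p1 : \sum_w uniform_popularity R n w = 1.
  by rewrite sumr_const card_ord -[LHS]mulr_natr mulVf// gt_eqF.
pose S := torus_square m d.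
pose F (a : assignment ('I_m * 'I_m)%type n) :=
  (k <= \max_s #|[set i | a i == Some s]|)%N &&
  ((\max_s #|[set i | a i == Some s]|)%:R <= c2 * L).
rewrite (Pr_assignment _ _ _ _ _ _ _ F).
pose cov (c : placement ('I_m * 'I_m)%type n M) := covered _ _ _ S c.
set del : R := expR (- L) + expR (- (L / 2)).
have bins c : cov c -> 1 - del <= \sum_(a | F a)
    \prod_i assigned_law R _ (@torus_adj m) n (uniform_popularity R n) M c (a i).
  move=> cc; set f := assigned_law _ _ _ _ _ _ _.
  have kn : (k <= n)%N.
    by rewrite -(ler_nat R) nE (le_trans kL)//; have := expR_ge1Dx L; lra.
  have f0 : forall o, 0 <= f o by move=> o; exact: assigned_law_ge0.
  have f1 : \sum_o f o = 1 by exact: assigned_law_sum1.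
  have fN : f None = 0 by exact: assigned_law_None cc.
  (* Squares of side [d] have radius at most [2 * d], so balls have at most
     [(4 * d + 1) ^ 2 <= 25 * d ^ 2] vertices; with [M * d ^ 2 <= 12 * n * L] this gives 25 * 12 =
     300. *)
  have fS s : n%:R * f (Some s) <= 300 * L.
    have := @assigned_law_Some_le R _ (@torus_adj m) n (uniform_popularity R n) M
      p0 S c (2 * d)%N ((5 * d) ^ 2)%N n%:R^-1 s.
    rewrite cardV invr_ge0 ler0n => /(_ isT (fun=> lexx _)) H.
    apply: le_trans (ler_wpM2l (ltW n0') (H _ _ cc)) _.
    - by move=> u t; exact: gdist_torus_square.
    - by apply: leq_trans (card_torus_ball _ _ _) _; rewrite leq_sqr; lia.
    - rewrite !mulrA divff ?gt_eqF// mul1r mulrC ler_pdivrMr// expnMn !natrM.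
      by move: Md; rewrite /n !natrX !expr2; lra.
  have kb : (0 < k <= n)%N by rewrite k0.
  have l0 : 0 < 300 * L by lra.
  have := balls_in_bins R _ f n k (300 * L) (c2 * L) cardV n0 kb l0 f0 f1 fN fS.
  move=> H; apply: le_trans (le_trans H _).
    (* The summand 2 in [c2] pays once for the factor [n] of the union bound and once for the
       remaining [expR (- L)]. *)
    have -> : n%:R * expR ((expR 1 - 1) * (300 * L) - c2 * L) = expR (- L).
      by rewrite nE -expRD c2E; congr expR; ring.
    rewrite lerB// /del lerD2l ler_pdivrMr// nE -expRD; apply: le_trans klow _.
    by rewrite ler_expR; lra.
  rewrite [leLHS]big_mkcond [leRHS]big_mkcond; apply: ler_sum => a _.
  have pr0 : 0 <= \prod_i f (a i) by exact: prodr_ge0.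
  case: ifP => [/andP[/existsP[s ks] /forallP all_le]|_]; last by case: ifP.
  rewrite /F (leq_trans ks) ?leq_bigmax//=.
  have [t ->] := @bigop.eq_bigmax ('I_m * 'I_m)%type (fun s => #|[set i | a i == Some s]|) V0.
  by rewrite all_le.
(* There are [n ^ 2] pairs of a vertex and a file, each missed with probability at most
   [expR (- (3 * L))]. *)
have bad : \sum_(c | ~~ cov c) placement_pmf (uniform_popularity R n) c <= expR (- L).
  have := @not_covered_le R _ n (uniform_popularity R n) M p0 p1 S (d ^ 2)%N (expR (- (3 * L))).
  move=> /(_ (fun u => card_torus_square _ _ u dm)).
  move=> H; apply: le_trans (H _) _.
    by move=> w; apply: one_sub_inv_exp_le => //; rewrite natrM.
  by rewrite cardV nE -!expRD ler_expR; lra.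
have tot := @placement_pmf_sum1 R ('I_m * 'I_m)%type n (uniform_popularity R n) M p1.
rewrite (bigID cov) /= in tot.
rewrite (bigID cov) /=.
apply: (@le_trans _ _ (\sum_(c | cov c) placement_pmf (uniform_popularity R n) c * (1 - del))).
  rewrite -mulr_suml; have := expR_ge0 (- L); have := expR_ge0 (- (L / 2)).
  have : 0 <= \sum_(c | ~~ cov c) placement_pmf (uniform_popularity R n) c.
    by apply: sumr_ge0 => c _; exact: placement_pmf_ge0.
  rewrite /del; nra.
rewrite -[leLHS]addr0 lerD//.
  by apply: ler_sum => c cc; rewrite ler_wpM2l ?placement_pmf_ge0 ?bins.
apply: sumr_ge0 => c _; rewrite mulr_ge0 ?placement_pmf_ge0//.
by apply: sumr_ge0 => a _; apply: prodr_ge0 => i _; apply: assigned_law_ge0.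
Qed.

(** * Asymptotic statement *)

Local Open Scope classical_set_scope.
Local Open Scope ring_scope.

Theorem theorem2 (R : realType) (alpha : R)
    (alpha_gt0 : 0 < alpha) (alpha_lt : alpha < 1 / 2) :
  exists c1 c2 c : R, [/\ 0 < c1, 0 < c2, 0 < c &
    \forall m \near \oo, forall M : nat,
      let n := (m ^ 2)%N in
      let K := n in
      `|M%:R - n%:R `^ alpha| < 1 ->
      1 - 1 / n%:R `^ c <=
        Pr (@torus_adj m) (uniform_popularity R K)
          (fun w : outcome ('I_m * 'I_m)%type K M n =>
            (c1 * (ln n%:R / ln (ln n%:R)) <= (max_load w)%:R) &&
            ((max_load w)%:R <= c2 * ln n%:R))].
Proof.
pose c2 : R := 300 * (expR 1 - 1) + 2.
exists (1 / 12), c2, (1 / 4); split; [lra| |lra|].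
  by rewrite /c2; have := expR_ge1Dx (1 : R); lra.
(* The first summand makes [ln L >= 100]. The second makes [alpha ^+ 2 * L >= 52], so that [n ^
   alpha >= (alpha * L) ^ 2 / 4 >= 13 * L] and [M >= 12 * L] despite the rounding of [M]. *)
pose L1 := expR 100 + 52 / alpha ^+ 2.
have L1alpha : 52 / alpha ^+ 2 > 0 by rewrite divr_gt0 ?exprn_gt0; lra.
have L1exp := expR_ge1Dx (100 : R).
near=> m.
move=> M; set n := (m ^ 2)%N => M_alpha.
have mL : expR L1 <= m%:R by near: m; exact: nbhs_infty_ger.
have m1 : (1 < m)%N.
  by rewrite -(ltr_nat R); have := expR_ge1Dx L1; rewrite /L1; lra.
have n0 : 0 < n%:R :> R by rewrite ltr0n expn_gt0; lia.
set L := ln n%:R.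
have nE : n%:R = expR L by rewrite lnK// posrE.
have mn : m%:R <= n%:R :> R by rewrite ler_nat /n -mulnn leq_pmulr//; lia.
have L1L : L1 <= L by rewrite -ler_expR -nE (le_trans mL).
have L100 : expR 100 <= L by rewrite /L1 in L1L; lra.
have Lpos : 0 < L by lra.
have lL : 100 <= ln L by rewrite -ler_expR lnK.
have aL : 52 <= alpha ^+ 2 * L.
  have : 52 / alpha ^+ 2 <= L by rewrite /L1 in L1L; have := expR_ge0 (100:R); lra.
  by rewrite ler_pdivrMr ?exprn_gt0// mulrC.
have powE : n%:R `^ alpha = expR (alpha * L).
  by rewrite /powR gt_eqF.
move: M_alpha; rewrite powE ltr_distl => /andP[Mlo Mhi].
have LM : 12 * L <= M%:R.
  have := sqr_le_4expR _ (alpha * L) (mulr_ge0 (ltW alpha_gt0) (ltW Lpos)).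
  rewrite exprMn expr2 mulrA; nra.
have ML : M%:R <= 3 * n%:R * L.
  have : expR (alpha * L) <= n%:R by rewrite nE ler_expR; nra.
  have : 1 <= n%:R :> R by rewrite nE -[leLHS]expR0 ler_expR; lra.
  by nra.
have [k [k0 kl kL klow]] := load_threshold R L ltac:(lra) lL.
have := max_load_bounds R m M k c2 L m1 (erefl _) (erefl _) Lpos LM ML k0 kL klow.
rewrite -/n => H; apply: le_trans (le_trans H _).
  rewrite lerD2l lerN2 div1r /powR gt_eqF// -/L.
  have -> : (expR (1 / 4 * L))^-1 = expR (- (L / 4)) by rewrite -expRN; congr expR; ring.
  (* With [y = n ^ (- 1 / 4)] the total error is [2 * y ^ 4 + y ^ 2], at most [y] because
     [y <= 1 / 3]; this is the exponent [c = 1 / 4]. *)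
  set y := expR (- (L / 4)).
  have -> : expR (- L) = y ^+ 4 by rewrite -expRM_natl; congr expR; field.
  have -> : expR (- (L / 2)) = y ^+ 2 by rewrite -expRM_natl; congr expR; field.
  have y0 : 0 < y by exact: expR_gt0.
  have y3 : y <= 1 / 3.
    rewrite /y expRN div1r lef_pV2 ?posrE ?expR_gt0//.
    by have := expR_ge1Dx (L / 4); lra.
  have y2 : y ^+ 2 <= y / 3 by nra.
  have y4 : y ^+ 4 <= y / 9 by rewrite (exprM _ 2 2); nra.
  lra.
rewrite /Pr [leLHS]big_mkcond [leRHS]big_mkcond; apply: ler_sum => w _.
have w0 : 0 <= nearest_replica_pmf (@torus_adj m) (uniform_popularity R n) w.
  rewrite /nearest_replica_pmf !mulr_ge0//.
  - by apply: placement_pmf_ge0 => x; rewrite invr_ge0.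
  - by apply: prodr_ge0 => i _; rewrite mulr_ge0 ?invr_ge0.
  - by apply: prodr_ge0 => i _; exact: choice_pmf_ge0.
case: ifP => [/andP[kw ->]|_]; last by case: ifP.
suff -> : 1 / 12 * (L / ln L) <= (max_load w)%:R by [].
apply: le_trans (le_trans kl _); last by rewrite ler_nat.
by rewrite [leRHS](_ : _ = 1 / 12 * (L / ln L)) ?lexx//; field; lra.
Unshelve. all: by end_near.
Qed.
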